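(* Fix $s>r\ge3$, let $M$ be the Fraïssé limit of the class of finite $K^r_s$-free $r$-graphs and $\mathcal{U}\succ M$ a sufficiently saturated elementary extension. Let $\phi(x_1,\dots,x_{r-1};y)$ be the formula $\neg R(x_1,\dots,x_{r-1},y)\wedge\bigwedge_{i\ne j}x_i\ne x_j$, and let $p_R\in S_\phi(\mathcal{U})$ be the complete $\phi$-type containing $\phi(\bar x;b)$ for all $b\in\mathcal{U}$. Then $p_R$ is dfs (definable and finitely satisfiable in some small model, in fact finitely satisfiable in $M$), but $p_R$ is not finitely approximated.
   Context: An $r$-graph is a set with an irreflexive symmetric $r$-ary relation $R$; $K^r_s$ is the complete $r$-graph on $s$ vertices; $T^r_s$ (the theory of $M$) is the theory of the Fraïssé limit of finite $K^r_s$-free $r$-graphs. $S_\phi(\mathcal{U})$ is the space of complete $\phi$-types over $\mathcal{U}$ (maximal consistent sets of instances $\phi(\bar x;b)$, $\neg\phi(\bar x;b)$, $b\in\mathcal{U}$). A $\phi$-type $p$ is definable if $\{b:\phi(\bar x;b)\in p\}$ is definable; finitely satisfiable in a small $N\prec\mathcal{U}$ if every finite subset of $p$ is realized in $N$; dfs if definable and finitely satisfiable in some small model. Viewing $p$ as a $\{0,1\}$-valued measure on $\phi$-formulas, $p$ is finitely approximated if there is a small $N\prec\mathcal{U}$ such that for every formula $\psi(\bar x;z)$ that is a finite Boolean combination of formulas $\phi(\bar x;y_i)$ and every $\epsilon>0$ there are $\bar a^1,\dots,\bar a^n$ from $N$ with $|p(\psi(\bar x;c))-\frac1n|\{t:\models\psi(\bar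 a^t;c)\}||<\epsilon$ for all $c$. *)

(* Defs.v *)
From mathcomp Require Import all_boot all_order all_fingroup all_algebra.
From mathcomp Require Import boolp classical_sets functions cardinality reals.

Set Implicit Arguments.
Unset Strict Implicit.
Unset Printing Implicit Defensive.

Local Open Scope classical_set_scope.
Local Open Scope card_scope.

(** * First-order logic over the language with one r-ary relation symbol *)

Record structure (r : nat) := Structure {
  carrier :> Type;
  interp : ('I_r -> carrier) -> Prop }.

Arguments interp {r} s _.

(** [formula r V]: formulas whose free variables are (some of the) elements of [V].
    [fAll] binds the variable [None]. A formula in the variables [X] with
    parameters from [A] is an element of [formula r (X + A)]. *)
Inductive formula (r : nat) (V : Type) : Type :=
| fBot
| fEq of V & V
| fRel of 'I_r -> V
| fImp of formula r V & formula r V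
| fAll of formula r (option V).

Arguments fBot {r V}.
Arguments fEq {r V} _ _.
Arguments fRel {r V} _.
Arguments fImp {r V} _ _.
Arguments fAll {r V} _.

Definition fNot {r V} (a : formula r V) : formula r V := fImp a fBot.
Definition fTop {r V} : formula r V := fNot fBot.
Definition fAnd {r V} (a b : formula r V) : formula r V := fNot (fImp a (fNot b)).

Fixpoint form_map {r V W} (h : V -> W) (a : formula r V) : formula r W :=
  match a with
  | fBot => fBot
  | fEq x y => fEq (h x) (h y)
  | fRel t => fRel (h \o t)
  | fImp b c => fImp (form_map h b) (form_map h c)
  | fAll b => fAll (form_map (omap h) b)
  end.

Fixpoint sat {r} (U : structure r) V (e : V -> U) (a : formula r V) : Prop :=
  match a with
  | fBot => False
  | fEq x y => e x = e y
  | fRel t => interp U (e \o t)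
  | fImp b c => sat e b -> sat e c
  | fAll b => forall u : U, sat (oapp e u) b
  end.

Definition sum_case {X Y Z : Type} (f : X -> Z) (g : Y -> Z) (v : X + Y) : Z :=
  match v with inl x => f x | inr y => g y end.

(** [psat a psi]: the tuple [a] satisfies the formula [psi], whose parameters
    are from [U] and interpreted as themselves. *)
Definition psat {r} {U : structure r} {X : Type} (a : X -> U)
    (psi : formula r (X + U)) : Prop :=
  sat (sum_case a id) psi.

Definition embedding {r} (A B : structure r) (f : A -> B) : Prop :=
  injective f /\ forall x : 'I_r -> A, interp A x <-> interp B (f \o x).

Definition automorphism {r} (A : structure r) (f : A -> A) : Prop :=
  embedding f /\ bijective f.

Definition elementary {r} (M U : structure r) (f : M -> U) : Prop :=
  forall n (a : formula r 'I_n) (e : 'I_n -> M), sat e a <-> sat (f \o e) a.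

Definition substructure {r} (U : structure r) (N : set U) : structure r :=
  @Structure r (set_type N) (fun x => interp U (set_val \o x)).

Definition elementary_sub {r} (U : structure r) (N : set U) : Prop :=
  elementary (fun x : substructure N => set_val x : U).

(** * Saturation; cardinals are represented by types *)

Definition small (K : Type) {T} (A : set T) : Prop :=
  A #<= [set: K] /\ ~ ([set: K] #<= A).

(** |K|-saturation: every 1-type over a set of fewer than |K| parameters is
    realized. *)
Definition saturated (K : Type) {r} (U : structure r) : Prop :=
  forall (A : set U) (S : set (formula r (unit + set_type A))),
    small K A ->
    (forall F, finite_set F -> F `<=` S ->
       exists u : U, forall a, F a -> sat (sum_case (fun=> u) set_val) a) ->
    exists u : U, forall a, S a -> sat (sum_case (fun=> u) set_val) a.

(** * Local types; [phi : formula r ('I_n + 'I_m)] is the partitioned formula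
    phi(x_1..x_n; y_1..y_m) *)

(** phi(x; b), where [b] is a tuple of parameters or of variables. *)
Definition instance {r n m} (phi : formula r ('I_n + 'I_m)) {Z : Type}
    (b : 'I_m -> Z) : formula r ('I_n + Z) :=
  form_map (sum_case inl (inr \o b)) phi.

Definition phi_instances {r n m} (phi : formula r ('I_n + 'I_m)) (U : structure r) :
    set (formula r ('I_n + U)) :=
  [set psi | exists b : 'I_m -> U, psi = instance phi b \/ psi = fNot (instance phi b)].

Arguments phi_instances {r n m} phi U _.

(** Every finite subset of [p] is realized in [N]. *)
Definition finitely_satisfiable {r n} {U : structure r} (N : set U)
    (p : set (formula r ('I_n + U))) : Prop :=
  forall F, finite_set F -> F `<=` p ->
    exists a : 'I_n -> U, (forall i, N (a i)) /\ forall psi, F psi -> psat a psi.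

Definition consistent {r n} {U : structure r} (p : set (formula r ('I_n + U))) :=
  finitely_satisfiable [set: U] p.

(** p is in S_phi(U). *)
Definition complete_type {r n m} (phi : formula r ('I_n + 'I_m)) {U : structure r}
    (p : set (formula r ('I_n + U))) : Prop :=
  [/\ p `<=` phi_instances phi U, consistent p &
      forall q, q `<=` phi_instances phi U -> consistent q -> p `<=` q -> q `<=` p].

Definition definable {r m} {U : structure r} (D : set ('I_m -> U)) : Prop :=
  exists chi : formula r ('I_m + U), forall b, D b <-> psat b chi.

Definition definable_type {r n m} (phi : formula r ('I_n + 'I_m)) {U : structure r}
    (p : set (formula r ('I_n + U))) : Prop :=
  definable [set b : 'I_m -> U | p (instance phi b)].

Definition dfs_type (K : Type) {r n m} (phi : formula r ('I_n + 'I_m)) {U : structure r}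
    (p : set (formula r ('I_n + U))) : Prop :=
  definable_type phi p /\
  exists N : set U, [/\ small K N, elementary_sub N & finitely_satisfiable N p].

(** psi(x; z_1..z_k) is a finite Boolean combination of formulas phi(x; y_i),
    where the y_i are tuples of variables among z_1..z_k. *)
Inductive bool_comb {r n m} (phi : formula r ('I_n + 'I_m)) {k} :
    formula r ('I_n + 'I_k) -> Prop :=
| bc_atom (y : 'I_m -> 'I_k) : bool_comb phi (instance phi y)
| bc_bot : bool_comb phi fBot
| bc_imp a b : bool_comb phi a -> bool_comb phi b -> bool_comb phi (fImp a b).

Definition entails {r n} {U : structure r} (p : set (formula r ('I_n + U)))
    (psi : formula r ('I_n + U)) : Prop :=
  exists F, [/\ finite_set F, F `<=` p &
    forall a : 'I_n -> U, (forall c, F c -> psat a c) -> psat a psi].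

Local Open Scope ring_scope.

(** The {0,1}-valued measure on phi-formulas associated with p. *)
Definition type_measure (R : realType) {r n} {U : structure r}
    (p : set (formula r ('I_n + U))) (psi : formula r ('I_n + U)) : R :=
  if `[< entails p psi >] then 1 else 0.

Definition finitely_approximated (R : realType) (K : Type) {r n m}
    (phi : formula r ('I_n + 'I_m)) {U : structure r}
    (p : set (formula r ('I_n + U))) : Prop :=
  exists N : set U, [/\ small K N, elementary_sub N &
    forall k (psi : formula r ('I_n + 'I_k)) (eps : R),
      bool_comb phi psi -> 0 < eps ->
      exists q (a : 'I_q -> 'I_n -> U),
        [/\ (0 < q)%N, forall t i, N (a t i) &
          forall c : 'I_k -> U,
            `| type_measure R p (instance psi c)
               - #|[set t | `[< psat (a t) (instance psi c) >]]%SET|%:R / q%:R |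
            < eps]].

(** * Hypergraphs *)

Definition is_rgraph {r} (A : structure r) : Prop :=
  (forall x, interp A x -> injective x) /\
  (forall (s : {perm 'I_r}) x, interp A x -> interp A (x \o s)).

Definition complete_rgraph (r s : nat) : structure r :=
  @Structure r 'I_s (fun x => injective x).

Definition clique_free {r} (s : nat) (A : structure r) : Prop :=
  ~ exists f : complete_rgraph r s -> A, embedding f.

(** M is a Fraisse limit of the class [C] of finite structures: M is countable
    and ultrahomogeneous, and its age is [C]. *)
Definition fraisse_limit {r} (C : structure r -> Prop) (M : structure r) : Prop :=
  [/\ countable [set: M],
      forall A : structure r, finite_set [set: A] ->
        ((exists f : A -> M, embedding f) <-> C A) &
      forall (A : set M) (f : substructure A -> M),
        finite_set A -> embedding f ->
        exists2 g : M -> M, automorphism g &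
          forall x : substructure A, g (set_val x) = f x].

Definition clique_free_rgraph {r} (s : nat) (A : structure r) : Prop :=
  is_rgraph A /\ clique_free s A.

(** The tuple (x_1, .., x_{r-1}, y); for r > 0 the last entry is y. *)
Definition snoc {r V} (x : 'I_r.-1 -> V) (y : V) : 'I_r -> V :=
  fun i => oapp x y (insub (val i)).

(** ~ R(x_1, .., x_{r-1}, y) /\ x_i <> x_j for all i <> j *)
Definition phi_nonedge (r : nat) : formula r ('I_r.-1 + 'I_1) :=
  fAnd (fNot (fRel (snoc inl (inr ord0))))
    (\big[fAnd/fTop]_(ij : 'I_r.-1 * 'I_r.-1 | ij.1 != ij.2)
       fNot (fEq (inl ij.1) (inl ij.2))).

(* Main.v *)
(** Adding a vertex y joined exactly to the rainbow (r-1)-sets of an (r-1)-coloured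
    finite vertex set creates no K_s (two of any r old vertices share a colour).
    Averaging over all colourings, any finite sequence of (r-1)-tuples has a fixed
    proportion of tuples on which phi(x; y) fails for a suitable y, so p_R is not
    finitely approximated.

    For finite satisfiability in M, suppose that every injective (r-1)-tuple of M is
    joined to one of b_1, .., b_n.  This colours the (r-1)-sets of M with n colours.
    There is a finite K_s-free r-graph in which every such colouring has a K_(s-1)
    all of whose (r-1)-subsets have the same colour i; together with b_i it is a
    K_s in U.  The r-graph comes from a partite construction in the manner of
    Nesetril and Rodl: start with disjoint copies of K_(s-1) over the subsets of a
    set of N parts, make the colouring depend only on the parts by treating one
    (r-1)-set t of parts at a time, and apply Ramsey's theorem to the parts. *)

Require Import Defs.
From mathcomp Require Import all_boot all_order all_fingroup all_algebra.
From mathcomp Require Import boolp classical_sets functions cardinality reals.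
Import Order.TTheory GRing.Theory Num.Theory.

Set Implicit Arguments.
Unset Strict Implicit.
Unset Printing Implicit Defensive.

Local Open Scope classical_set_scope.

(** * Satisfaction *)

Lemma sat_form_map {r} (U : structure r) V W (h : V -> W) (e : W -> U)
    (a : formula r V) : sat e (form_map h a) <-> sat (e \o h) a.
Proof.
elim: a W h e => [{}V|{}V x y|{}V t|{}V b IHb c IHc|{}V b IHb] W h e //=.
  by split=> H /(IHb _ h e) /H /(IHc _ h e).
have E u : oapp (e \o h) u = oapp e u \o omap h by apply: funext; case.
by split=> H u; [rewrite E; apply/IHb | apply/IHb; rewrite -E].
Qed.

Lemma sat_fAnd {r} (U : structure r) V (e : V -> U) (a b : formula r V) :
  sat e (fAnd a b) <-> sat e a /\ sat e b.
Proof.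
split=> /=; last by case=> ha hb; apply.
by move=> H; split; apply: contrapT => N; apply: H => // ha hb; apply: N.
Qed.

Lemma sat_bigAnd {r} (U : structure r) V (e : V -> U) (I : finType) (P : pred I)
    (F : I -> formula r V) :
  sat e (\big[fAnd/fTop]_(i | P i) F i) <-> forall i, P i -> sat e (F i).
Proof.
have H (l : seq I) : sat e (\big[fAnd/fTop]_(i <- l | P i) F i) <->
    forall i, i \in l -> P i -> sat e (F i).
  elim: l => [|x l IH]; first by rewrite big_nil /=; split.
  rewrite big_cons; split.
    move=> H i; rewrite inE => /predU1P[-> Px|il Pi].
      by move: H; rewrite Px => /sat_fAnd[].
    by apply: (IH.1 _ i il Pi); move: H; case: ifP => // _ /sat_fAnd[].
  move=> H; have Hl : sat e (\big[fAnd/fTop]_(i <- l | P i) F i).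
    by apply/IH => i il; apply: H; rewrite inE il orbT.
  case: ifP => // Px; apply/sat_fAnd; split=> //.
  by apply: H => //; rewrite mem_head.
rewrite H; split=> G i; last by move=> _; apply: G.
by apply: G; rewrite mem_index_enum.
Qed.

(** Quantifying the last variable universally reduces, by induction on [n], to formulas without free
    variables, which [f] transfers. Tuples of [U] outside the image of [f] are thereby reached. *)
Lemma elementary_forall {r} (M U : structure r) (f : M -> U) : elementary f ->
  forall n (a : formula r 'I_n), (forall e : 'I_n -> M, sat e a) ->
  forall e : 'I_n -> U, sat e a.
Proof.
move=> fE; elim=> [|n IHn] a Ma e.
  have e0 : 'I_0 -> M by case.
  suff -> : e = f \o e0 by apply/fE.
  by apply: funext; case.
pose b : formula r 'I_n := fAll (form_map (unlift ord_max) a).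
have /(_ (e \o lift ord_max))/= /(_ (e ord_max)) : forall e : 'I_n -> U, sat e b.
  by apply: IHn => e' u /=; apply/sat_form_map.
move/sat_form_map; congr sat; apply: funext => i /=.
by case: unliftP => [k|] -> .
Qed.

Lemma sat_iso {r} (A B : structure r) (f : A -> B) : embedding f ->
  (forall b, exists a, f a = b) ->
  forall V (a : formula r V) (e : V -> A), sat e a <-> sat (f \o e) a.
Proof.
move=> [finj fR] fsurj V; elim=> {V}[V|V x y|V t|V b IHb c IHc|V b IHb] e //=.
- by split=> [->|/finj].
- by split=> H /IHb /H /IHc.
- have E u : oapp (f \o e) (f u) = f \o oapp e u by apply: funext; case.
  split=> H u; last by apply/IHb; rewrite -E.
  by have [u' <-] := fsurj u; rewrite E; apply/IHb.
Qed.

Lemma elementary_embedding {r} (M U : structure r) (f : M -> U) :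
  elementary f -> embedding f.
Proof.
move=> fE; split=> [x y fxy|x]; last exact: (fE r (fRel id) x).
pose e (i : 'I_2) := if i == ord0 then x else y.
exact: ((fE 2 (fEq ord0 ord_max) e).2 fxy).
Qed.

(** [f] factors as an isomorphism onto its range followed by the inclusion. *)
Lemma elementary_sub_range {r} (M U : structure r) (f : M -> U) :
  elementary f -> elementary_sub (range f).
Proof.
move=> fE n a e.
have Nf x : range f (f x) by exists x.
pose g (x : M) : substructure (range f) := SigSub (mem_set (Nf x)).
have gE : embedding g.
  have [finj fR] := elementary_embedding fE.
  split=> [x y /(congr1 set_val)/finj //|x]; exact: fR.
have gsurj b : exists a, g a = b.
  by have [x _ xb] := set_valP b; exists x; apply: val_inj.
have [e' e'P] := choice (fun i => gsurj (e i)).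
have -> : e = g \o e' by apply: funext => i; rewrite /= e'P.
rewrite -(sat_iso gE gsurj); exact: fE.
Qed.

Lemma finite_enum T (A : set T) : finite_set A ->
  exists n (f : 'I_n -> T), forall x, A x -> exists i, f i = x.
Proof.
move=> /(@finite_seqP {classic T})[l lE].
exists (size l), (tnth (in_tuple l)) => x Ax.
have xl : (x : {classic T}) \in l by move: Ax; rewrite lE.
by have /tnthP[i ->] : (x : {classic T}) \in in_tuple l by []; exists i.
Qed.

(** * Hypergraph Ramsey theorem and boxes *)

(** Subsets are encoded as subsequences of a duplicate-free list. Induction on [k] yields a list on
    which the colour of a set depends only on its first element; the pigeonhole principle on first
    elements finishes. *)
Lemma ramsey (C : finType) k l : exists N,
  forall (T : eqType) (L : seq T) (chi : seq T -> C), uniq L -> N <= size L ->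
  exists L' c, [/\ subseq L' L, size L' = l &
    forall u, subseq u L' -> size u = k -> chi u = c].
Proof.
elim: k l => [|k IHk] l.
  exists l => T L chi _ lL; exists (take l L), (chi [::]).
  by split; rewrite ?take_subseq ?size_takel// => u _ /size0nil ->.
have end_homogeneous m : exists N, forall (T : eqType) (L : seq T)
    (chi : seq T -> C), uniq L -> N <= size L -> exists L' (c : T -> C),
      [/\ subseq L' L, size L' = m &
      forall x u, subseq (x :: u) L' -> size u = k -> chi (x :: u) = c x].
  elim: m => [|m [N0 IHm]].
    by exists 0 => T L chi _ _; exists [::], (fun=> chi [::]); split; rewrite ?sub0seq.
  have [N1 IH1] := IHk N0; exists N1.+1 => T [//|x L] chi /= /andP[xL uL] sL.
  have [L2 [cx [sL2 szL2 HL2]]] := IH1 T L (fun u => chi (x :: u)) uL sL.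
  have [|L3 [c [sL3 szL3 HL3]]] := IHm T L2 chi (subseq_uniq sL2 uL).
    by rewrite szL2.
  exists (x :: L3), (fun z => if z == x then cx else c z); split.
  - by rewrite eqxx (subseq_trans sL3).
  - by rewrite /= szL3.
  - move=> z u /=; case: eqP => [->|_]; last exact: HL3.
    by move=> uL3; apply: HL2; apply: subseq_trans sL3.
have [N HN] := end_homogeneous (l * #|C|).+1.
exists N => T L chi uL /(HN T L chi uL) [L' [c [sL' szL' HL']]].
have [a Ha] : exists a, l <= count (fun x => c x == a) L'.
  apply: contrapT => /forallNP H; have : (l * #|C|).+1 <= l * #|C|; last by rewrite ltnn.
  rewrite -{1}szL' -sum1_size (partition_big c predT)//= mulnC -sum_nat_const.
  by apply: leq_sum => a _; rewrite sum1_count ltnW// ltnNge; apply/negP.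
set L2 := [seq x <- L' | c x == a].
have sL2 : subseq (take l L2) L' := subseq_trans (take_subseq _ _) (filter_subseq _ _).
exists (take l L2), a; split.
- exact: subseq_trans sL'.
- by rewrite size_takel// size_filter.
- case=> // x u sxu [szu]; rewrite (HL' x u (subseq_trans sxu sL2) szu).
  have /mem_take : x \in take l L2 by apply: (mem_subseq sxu); rewrite mem_head.
  by rewrite mem_filter => /andP[/eqP].
Qed.

Lemma pigeonhole_inj (X Z A : finType) (F : Z -> A) : #|X| * #|A| < #|Z| ->
  exists (a : A) (y : X -> Z), injective y /\ forall x, F (y x) = a.
Proof.
move=> lt; have [a Ha] : exists a, #|X| <= #|[pred z | F z == a]|.
  apply: contrapT => /forallNP H; move: lt; rewrite ltnNge => /negP; apply.
  rewrite -sum1_card (partition_big F predT)//= mulnC -sum_nat_const.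
  apply: leq_sum => a _; rewrite sum1_card ltnW// ltnNge; exact/negP/H.
pose y x := enum_val (widen_ord Ha (enum_rank x)).
exists a, y; split=> [x1 x2 /enum_val_inj/(congr1 val)/= /val_inj/enum_rank_inj//|x].
by have := enum_valP (widen_ord Ha (enum_rank x)); rewrite inE => /eqP.
Qed.

(** A large complete multipartite system over [t] contains, for every colouring, a one-coloured copy
    of the system formed by the fibres of [pi]. Each label over the first part gets from the
    induction a labelling and a colour for the rest; many labels share the same outcome. *)
Lemma box (N : eqType) (X : finType) (C : finType) (pi : X -> N) (t : seq N) : uniq t ->
  exists Z : finType, forall chi : seq (N * Z) -> C, exists (y : X -> Z) (c : C),
    (forall x x', pi x = pi x' -> y x = y x' -> x = x') /\
    forall u, map pi u = t -> chi [seq (pi x, y x) | x <- u] = c.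
Proof.
elim: t => [_|i t IHt /= /andP[it /IHt{IHt}[Z1 IH]]].
  by exists X => chi; exists id, (chi [::]); split=> [x x' _ ->|[]].
(* [A] is the set of outcomes for the rest of [t]; [option] adds the one element that makes [Z0]
   larger than [X * A]. *)
pose A := ({ffun X -> Z1} * C)%type; pose Z0 := option (X * A).
exists (Z0 + Z1)%type => chi.
pose chi' (z : Z0) (w : seq (N * Z1)) :=
  chi ((i, inl z) :: [seq (p.1, inr p.2) | p <- w]).
have /choice[F HF] z : exists a : A,
   (forall x x', pi x = pi x' -> a.1 x = a.1 x' -> x = x') /\
    forall u, map pi u = t -> chi' z [seq (pi x, a.1 x) | x <- u] = a.2.
  have [y [c [yinj yc]]] := IH (chi' z).
  exists ([ffun x => y x], c); split=> [x x'|u /yc <-] /=; first by rewrite !ffunE; apply: yinj.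
  by congr chi'; apply: eq_map => x; rewrite ffunE.
have [|a [y0 [y0inj y0a]]] := @pigeonhole_inj X Z0 A F.
  by rewrite card_option ltnS (card_prod X A).
(* Labels over the part [i] come from [Z0], all others from the common outcome [a]. *)
exists (fun x => if pi x == i then inl (y0 x) else inr (a.1 x)), a.2; split.
  move=> x x' pixx'; rewrite pixx'; case: ifP => _ [].

    exact: y0inj.
  by move=> e; apply: (HF (y0 x)).1; rewrite ?y0a.
case=> [|x u] //= [-> ut]; rewrite eqxx -(y0a x).
rewrite -((HF (y0 x)).2 u ut); congr (chi (_ :: _)); rewrite -map_comp.
apply/eq_in_map => x' x'u /=; rewrite y0a; case: eqP => // pix'.
by move: it; rewrite -ut -pix' map_f.
Qed.

(** * The partite construction *)

Definition clique_map {r s} (A : Type) (E : ('I_r -> A) -> Prop)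
    (h : 'I_s -> A) :=
  forall x : 'I_r -> 'I_s, injective x -> E (h \o x).

(** Puts prescribed vertices of a clique into one edge: list [l] first, then the other indices, and
    keep the first [r]. *)
Lemma injection_through r s (l : seq 'I_s) : uniq l -> size l <= r -> r <= s ->
  exists2 x : 'I_r -> 'I_s, injective x & forall k, k \in l -> exists i, x i = k.
Proof.
move=> ul lr rs; pose l' := l ++ [seq k <- enum 'I_s | k \notin l].
have ul' : uniq l'.
  rewrite cat_uniq ul filter_uniq ?enum_uniq// andbT.
  by apply/hasPn => k; rewrite mem_filter => /andP[].
have sl' : size l' = s.
  rewrite -[RHS]size_enum_ord; apply/perm_size/uniq_perm; rewrite ?enum_uniq// => k.
  by rewrite mem_cat mem_filter mem_enum andbT orbN.
case: s l ul lr rs @l' ul' sl' => [|s] l ul lr rs l' ul' sl'.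
  have r0 : r = 0 by apply/eqP; rewrite -leqn0.
  rewrite {}r0 in lr *.
  by exists id => // k; case: (l) lr.
exists (fun i : 'I_r => nth ord0 l' i).
  move=> i1 i2 /eqP; rewrite nth_uniq ?sl' ?(leq_trans _ rs)// => /eqP; exact: val_inj.
move=> k kl; have lt : index k l < r by rewrite (leq_trans _ lr) ?index_mem.
by exists (Ordinal lt); rewrite /= /l' nth_cat index_mem kl nth_index.
Qed.

Lemma pigeonhole_seq (I : finType) (T : eqType) (f : I -> T) (l : seq T) :
  injective f -> size l < #|I| -> exists i, f i \notin l.
Proof.
move=> finj sl; apply: contrapT => /forallNP H.
have : size [seq f i | i <- enum I] <= size l.
  apply: uniq_leq_size; first by rewrite map_inj_uniq// enum_uniq.
  by move=> _ /mapP[i _ ->]; apply/negPn/negP.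
by rewrite size_map -cardE leqNgt sl.
Qed.

Section PartiteConstruction.
Variables (r s N : nat) (C : finType).
Hypotheses (r3 : 3 <= r) (rs : r < s).

(** [pi] maps a vertex to its part. *)
Definition partite_free (X : finType) (pi : X -> 'I_N) (E : ('I_r -> X) -> Prop) :=
  [/\ forall x, E x -> injective (pi \o x),
      forall (p : {perm 'I_r}) x, E x -> E (x \o p) &
      forall h : 'I_s -> X, ~ clique_map E h].

(** [g S] is a copy of K_(s-1) over the set [S] of parts. *)
Definition arrows (T : seq (seq 'I_N)) (X : finType) (pi : X -> 'I_N)
    (E : ('I_r -> X) -> Prop) :=
  forall chi : seq X -> C, exists g : s.-1.-tuple 'I_N -> 'I_N -> X,
  [/\ forall S i, pi (g S i) = i,
      forall S (x : 'I_r -> 'I_N), injective x -> (forall k, x k \in S) -> E (g S \o x) &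
      forall t, t \in T -> exists c : C, forall S : s.-1.-tuple 'I_N, {subset t <= S} ->
        chi (map (g S) t) = c].

(** Two vertices of a clique share an edge, hence have the same [S] and distinct second coordinates
    in [S]; as [S] has only [s - 1] entries, there is no [s]-clique. *)
Lemma arrows_nil : exists (X : finType) (pi : X -> 'I_N) E,
  partite_free pi E /\ arrows [::] pi E.
Proof.
pose X := (s.-1.-tuple 'I_N * 'I_N)%type.
pose E (x : 'I_r -> X) := [/\ injective (snd \o x),
  forall k l, (x k).1 = (x l).1 & forall k, (x k).2 \in (x k).1].
exists X, snd, E; split; first split.
- by move=> x [].
- move=> p x [xinj x1 x2]; split=> [k l /xinj/perm_inj//|k l|k]; [exact: x1|exact: x2].
- move=> h hE.
  have H k l : k != l -> exists2 x, E (h \o x) & exists a b : 'I_r, x a = k /\ x b = l.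
    move=> kl; have [|||x xinj xP] := @injection_through r s [:: k; l].
    + by rewrite /= inE kl.
    + exact: ltn_trans r3.
    + exact: ltnW.
    exists x; first exact: hE.
    have [a xa] := xP k (mem_head _ _).
    have [b xb] : exists i, x i = l by apply: xP; rewrite !inE eqxx orbT.
    by exists a, b.
  have s0 : 0 < s by apply: leq_ltn_trans rs.
  have s1 : 1 < s by apply: ltn_trans rs; apply: ltn_trans r3.
  pose k0 := Ordinal s0; pose k1 := Ordinal s1.
  have h1 k : (h k).1 = (h k0).1.
    case: (eqVneq k k0) => [->//|/H[x [_ xE _] [a [b [<- <-]]]]]; exact: xE.
  have h2 k : (h k).2 \in (h k0).1.
    have [l /H[x [_ _ xE] [a [b [<- _]]]]] : exists l, k != l.
      by exists (if k == k0 then k1 else k0); case: (eqVneq k k0) => [->|].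
    by rewrite -(h1 (x a)); apply: xE.
  have [||k] := @pigeonhole_seq 'I_s 'I_N (snd \o h) (h k0).1.
  + move=> k l /= e; case: (eqVneq k l) => // /H[x [xinj _ _] [a [b [xa xb]]]].
    by rewrite -xa -xb; congr x; apply: xinj; rewrite /= xa xb.
  + by rewrite size_tuple card_ord ltn_predL.
  + by rewrite h2.
- move=> chi; exists (fun S i => (S, i)); split=> // S x xinj xS; split=> //.
Qed.

(** Copies [f y] of [X] are glued along a box over the parts in [t], which is large
    enough to contain, for every colouring, a copy whose [t]-tuples have one colour. *)
Lemma arrows_cons (t : seq 'I_N) T (X : finType) (pi : X -> 'I_N) E :
  uniq t -> size t = r.-1 -> partite_free pi E -> arrows T pi E ->
  exists (X' : finType) (pi' : X' -> 'I_N) E',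
    partite_free pi' E' /\ arrows (t :: T) pi' E'.
Proof.
move=> ut st [Epi Eperm Efree] Earr.
have [Z HZ] := box C pi ut.
pose X' := ('I_N * Z + X * {ffun X -> Z})%type.
pose pi' (v : X') := match v with inl p => p.1 | inr p => pi p.1 end.
(* Vertices over the parts in [t] go into the common box; all others carry the label [y] of their
   copy. *)
pose f (y : {ffun X -> Z}) (x : X) : X' :=
  if pi x \in t then inl (pi x, y x) else inr (x, y).
have pi'f y x : pi' (f y x) = pi x by rewrite /f; case: ifP.
pose E' (v : 'I_r -> X') := exists y x, [/\ injective (f y), E x & v = f y \o x].
have E'pi v : E' v -> injective (pi' \o v).
  move=> [y [x [_ Ex ->]]] k l /=; rewrite !pi'f; exact: Epi.
(* An edge meets more parts than [t] has, hence determines the copy. *)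
have lift_edge y x v : injective (f y) -> E' v -> v = f y \o x -> E x.
  move=> yinj [y' [x' [_ Ex' ->]]] e.
  have [||k kt] := @pigeonhole_seq 'I_r _ (pi \o x') t; first exact: Epi.
    by rewrite card_ord st prednK// (ltn_trans _ r3).
  have ek := congr1 (@^~ k) e.
  have eyy : y' = y.
    move: ek kt; rewrite /f /=; case: ifP => // _; case: ifP => // _ [_ ->//].
  suff -> : x = x' by [].
  by apply: funext => l; apply: yinj; have := congr1 (@^~ l) e; rewrite /= eyy.
exists X', pi', E'; split; first split => //.
- by move=> p v [y [x [yinj Ex ->]]]; exists y, (x \o p); split=> //; apply: Eperm.
- move=> h hE'.
  have H k l : exists2 x, E' (h \o x) & exists a b : 'I_r, x a = k /\ x b = l.
    have [|||x xinj xP] := @injection_through r s (undup [:: k; l]).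
    + exact: undup_uniq.
    + by apply: leq_trans (size_undup _) _; apply: ltn_trans r3.
    + exact: ltnW.
    exists x; first exact: hE'.
    have [a xa] : exists i, x i = k by apply: xP; rewrite mem_undup mem_head.
    have [b xb] : exists i, x i = l by apply: xP; rewrite mem_undup !inE eqxx orbT.
    by exists a, b.
  (* A clique meets [s > r - 1] parts, so some [h k0] lies outside the parts in [t] and its label
     [y0] fixes a copy. Every vertex shares an edge with [h k0], so the clique lies in that copy and
     lifts to [X]. *)
  have [||k0 k0t] := @pigeonhole_seq 'I_s _ (pi' \o h) t.
    move=> k l /= e; have [x /E'pi xinj [a [b [xa xb]]]] := H k l.
    by rewrite -xa -xb; congr x; apply: xinj; rewrite /= xa xb.
    by rewrite card_ord st (leq_ltn_trans (leq_pred r)).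
  have [x0 [y0 hk0]] : exists x0 y0, h k0 = inr (x0, y0).
    have [x [y [x' [_ _ e]]] [a [_ [xa _]]]] := H k0 k0.
    have := congr1 (@^~ a) e; rewrite /= xa => ea; move: k0t.
    rewrite /= ea pi'f /f => /negbTE ->; by exists (x' a), y.
  have /choice[g gP] : forall k, exists x, f y0 x = h k.
    move=> k; have [x [y [x' [_ _ e]]] [a [b [xa xb]]]] := H k0 k.
    have := congr1 (@^~ a) e; rewrite /= xa hk0 /f; case: ifP => // _ [_ ey].
    by exists (x' b); rewrite ey -xb; have := congr1 (@^~ b) e.
  have y0inj : injective (f y0).
    have [x [y [x' [yinj _ e]]] [a [b [xa xb]]]] := H k0 k0.
    have := congr1 (@^~ a) e; rewrite /= xa hk0 /f; case: ifP => // _ [_ ey].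
    by rewrite ey.
  apply: (Efree g) => x xinj; apply: (lift_edge y0 _ (h \o x)) => //.
    exact: hE'.
  by apply: funext => k; rewrite /= gP.
- move=> chi.
  (* The box gives a copy [f y] in which all sequences over [t] have one colour; the arrow property
     of [X] is then applied inside this copy. *)
  pose chi' (w : seq ('I_N * Z)) := chi [seq inl p | p <- w].
  have [y' [c [y'inj yc]]] := HZ chi'.
  pose y := [ffun x => y' x].
  have yinj : injective (f y).
    move=> x1 x2; rewrite /f; case: ifP => _; case: ifP => // _ [].
      rewrite !ffunE; exact: y'inj.
    by [].
  have [g [gpi gE gT]] := Earr (chi \o map (f y)).
  exists (fun S i => f y (g S i)); split.
  + by move=> S i; rewrite pi'f.
  + by move=> S x xinj xS; exists y, (g S \o x); split=> //; apply: gE.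
  + move=> t'; rewrite inE => /predU1P[->|/gT[c' c'P]]; last first.
      by exists c' => S /c'P <-; rewrite /= -map_comp.
    exists c => S tS; rewrite -(yc (map (g S) t)); last first.
      by rewrite -map_comp; apply: map_id_in => i _ /=.
    rewrite /chi' -!map_comp; congr chi; apply/eq_in_map => i it /=.
    by rewrite /f gpi it ffunE.
Qed.

End PartiteConstruction.

(** Treating all duplicate-free (r-1)-sequences of parts in turn makes the colour depend on the
    parts only; Ramsey's theorem on the [N] parts then selects [S], and [g S] gives the clique over
    it. *)
Lemma clique_ramsey r s (C : finType) : 3 <= r -> r < s ->
  exists (X : finType) (E : ('I_r -> X) -> Prop),
  [/\ forall x, E x -> injective x,
      forall (p : {perm 'I_r}) x, E x -> E (x \o p),
      forall h : 'I_s -> X, ~ clique_map E h &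
      forall chi : seq X -> C, exists (K : s.-1.-tuple X) (c : C),
        [/\ uniq K, forall x : 'I_r -> X, injective x -> (forall k, x k \in K) -> E x &
        forall u, subseq u K -> size u = r.-1 -> chi u = c]].
Proof.
move=> r3 rs; have [N HN] := @ramsey C r.-1 s.-1.
have step (T : seq (seq 'I_N)) : (forall t, t \in T -> uniq t /\ size t = r.-1) ->
    exists (X : finType) (pi : X -> 'I_N) (E : ('I_r -> X) -> Prop),
    partite_free s pi E /\ arrows s C T pi E.
  elim: T => [_|t T IHT TP]; first exact: arrows_nil.
  have [|X [pi [E [Efree Earr]]]] := IHT.
    by move=> t' t'T; apply: TP; rewrite inE t'T orbT.
  have [ut st] := TP t (mem_head _ _); exact: arrows_cons ut st Efree Earr.
have [|X [pi [E [[Epi Eperm Efree] Earr]]]] :=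
    step [seq val t | t in [pred t : r.-1.-tuple 'I_N | uniq t]].
  by move=> _ /fintype.imageP[t ut ->]; rewrite size_tuple.
exists X, E; split=> //.
  by move=> x /Epi xinj k l e; apply: xinj; rewrite /= e.
move=> chi; have [g [gpi gE gT]] := Earr chi.
(* [c] is the induced colouring of sequences of parts, with default [chi [::]] on sequences of the
   wrong length or with repetitions. *)
have /choice[c cP] : forall u : seq 'I_N, exists c : C, uniq u -> size u = r.-1 ->
    forall S : s.-1.-tuple 'I_N, {subset u <= S} -> chi (map (g S) u) = c.
  move=> u; case: (boolP (uniq u && (size u == r.-1))) => [/andP[uu su]|nu]; last first.
    by exists (chi [::]) => uu su; move: nu; rewrite uu su eqxx.
  have [|c cP] := gT u; last by exists c.
  by apply/fintype.imageP; exists (Tuple su).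
have [||L [c0 [sL szL HL]]] := HN _ (enum 'I_N) c; first exact: enum_uniq.
  by rewrite size_enum_ord.
pose S : s.-1.-tuple 'I_N := Tuple (introT eqP szL).
have uS : uniq S := subseq_uniq sL (enum_uniq _).
have piK v : v \in map (g S) S -> g S (pi v) = v /\ pi v \in S.
  by move=> /mapP[i iS ->]; rewrite gpi.
exists (map_tuple (g S) S), c0; split.
- by rewrite map_inj_uniq// => i i' /(congr1 pi); rewrite !gpi.
- move=> x xinj xK; have -> : x = g S \o (pi \o x).
    by apply: funext => k /=; rewrite (piK _ (xK k)).1.
  apply: gE => [k l /= e|k]; last exact: (piK _ (xK k)).2.
  by apply: xinj; rewrite -(piK _ (xK k)).1 e (piK _ (xK l)).1.
- move=> u uK su; have uE : u = map (g S) (map pi u).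
    rewrite -map_comp; apply/esym/map_id_in => v /(mem_subseq uK) vK /=.
    exact: (piK _ vK).1.
  have spi : subseq (map pi u) S.
    have -> : tval S = map pi (map (g S) S).
      by rewrite -map_comp; apply/esym/map_id_in => i _ /=.
    exact: map_subseq.
  rewrite uE (cP (map pi u) _ _ S).
  + by apply: HL; rewrite ?size_map.
  + exact: subseq_uniq spi uS.
  + by rewrite size_map.
  + exact: mem_subseq.
Qed.

(** * The Fraisse limit *)

(** The [r] entries of an edge are distinct, so an [r]-tuple covering them all is a rearrangement of
    it. *)
Lemma rgraph_range {r} (A : structure r) (x y : 'I_r -> A) : is_rgraph A ->
  (forall l, exists k, y k = x l) -> interp A x -> interp A y.
Proof.
move=> [Ainj Aperm] /choice[f fP] Ax.
have finj : injective f by move=> k l kl; apply: (Ainj x Ax); rewrite -!fP kl.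
suff -> : y = x \o (perm finj)^-1%g by apply: Aperm.
by apply: funext => k; rewrite /= -fP -[in RHS](permE finj) permKV.
Qed.

Lemma snoc_lt r V (x : 'I_r.-1 -> V) y (k : 'I_r) (kr : k < r.-1) :
  snoc x y k = x (Ordinal kr).
Proof. by rewrite /snoc insubT. Qed.

Lemma snoc_last r V (x : 'I_r.-1 -> V) y (k : 'I_r) : r.-1 <= k -> snoc x y k = y.
Proof. by move=> kr; rewrite /snoc insubF// ltnNge kr. Qed.

Lemma clique_map_inj r s (A : Type) (E : ('I_r -> A) -> Prop) (h : 'I_s -> A) :
  1 < r -> r <= s -> (forall x, E x -> injective x) ->
  clique_map E h -> injective h.
Proof.
move=> r1 rs Einj hE k l hkl; apply/eqP/negPn/negP => kl.
have [|||x xinj xP] := @injection_through r s [:: k; l] => //.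
  by rewrite /= inE kl.
have [a xa] := xP k (mem_head _ _).
have [b xb] : exists i, x i = l by apply: xP; rewrite !inE eqxx orbT.
have ab : a = b by apply: (Einj _ (hE x xinj)); rewrite /= xa xb.
by move: kl; rewrite -xa -xb ab eqxx.
Qed.

Section FraisseLimit.
Variables (r s : nat) (M : structure r).
Hypotheses (r3 : 3 <= r) (rs : r < s) (ML : fraisse_limit (clique_free_rgraph s) M).

(** Both axioms concern the entries of a single tuple, and the finite substructure on these belongs
    to the age. *)
Lemma limit_rgraph : is_rgraph M.
Proof.
have [_ age _] := ML.
pose lft (x : 'I_r -> M) k : substructure (range x) := SigSub (mem_set (imageT x k)).
have sub (x : 'I_r -> M) : is_rgraph (substructure (range x)).
  have fin : finite_set [set: substructure (range x)].
    have -> : [set: substructure (range x)] = range (lft x).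
      apply/seteqP; split=> // u _; have [k _ xk] := set_valP u.
      by exists k => //; apply: val_inj.
    by apply: finite_image; exact: (@finite_finset 'I_r setT).
  suff /(age _ fin)[] : exists f : substructure (range x) -> M, embedding f by [].
  by exists set_val; split=> //; apply: val_inj.
split=> [x Mx k l xkl|p x Mx].
  apply: ((sub x).1 (lft x) Mx); apply: val_inj; exact: xkl.
exact: (sub x).2 p (lft x) Mx.
Qed.

Lemma limit_clique_free (h : 'I_s -> M) : ~ clique_map (interp M) h.
Proof.
move=> hE; have [_ age _] := ML.
have fin : finite_set [set: complete_rgraph r s] := @finite_finset 'I_s setT.
have Mrg := limit_rgraph.
have [] : clique_free_rgraph s (complete_rgraph r s).
  apply/(age _ fin); exists h; split.
    by apply: clique_map_inj hE; [exact: ltn_trans r3|exact: ltnW|exact: Mrg.1].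
  move=> x; split; first exact: hE.
  by move=> /Mrg.1 hx k l xkl; apply: hx; rewrite /= xkl.
move=> _; apply; exists id; by split.
Qed.

Lemma limit_embeds (X : finType) (E : ('I_r -> X) -> Prop) :
  (forall x, E x -> injective x) -> (forall (p : {perm 'I_r}) x, E x -> E (x \o p)) ->
  (forall h : 'I_s -> X, ~ clique_map E h) ->
  exists f : X -> M, injective f /\ forall x, E x <-> interp M (f \o x).
Proof.
move=> Einj Eperm Efree; have [_ age _] := ML.
apply/(age (Structure E)); first exact: (@finite_finset X setT).
split=> // -[h [_ hE]]; apply: (Efree h) => x xinj; exact: (hE x).1.
Qed.

(** The old vertices [v] with one new vertex [None], joined to the rainbow sets of [c], form a graph
    in the age; homogeneity moves its copy in [M] onto [v]. *)
Lemma limit_extension m (v : 'I_m -> M) (c : 'I_m -> 'I_r.-1) : injective v ->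
  exists y, forall i : 'I_r.-1 -> 'I_m, (forall k, c (i k) = k) ->
    interp M (snoc (v \o i) y).
Proof.
move=> vinj; pose X := option 'I_m.
have [Minj Mperm] := limit_rgraph.
(* In edges of the second kind [None] counts as an [r]-th colour. *)
pose E (x : 'I_r -> X) := (exists2 x', x = Some \o x' & interp M (v \o x')) \/
  injective (omap c \o x) /\ exists k, x k = None.
have [| | |f [finj fE]] := @limit_embeds X E.
- move=> x [[x' -> /Minj xinj] k l [kl]|[xinj _] k l kl]; apply: xinj; by rewrite /= kl.
- move=> p x [[x' -> Mx]|[xinj [k xk]]].
    by left; exists (x' \o p) => //; apply: (Mperm p (v \o x')).
  right; split; first by move=> a b /xinj/perm_inj.
  by exists (p^-1%g k); rewrite /= permKV.
- move=> h hE.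
  have hinj : injective h.
    apply: clique_map_inj hE; [exact: ltn_trans r3|exact: ltnW|].
    by move=> x [[x' -> /Minj xinj] k l [kl]|[xinj _] k l kl]; apply: xinj; rewrite /= kl.
  have [[k0 hk0]|/forallNP hN] := pselect (exists k, h k = None); last first.
    have /choice[g gP] : forall k, exists u, h k = Some u.
      by move=> k; case: (h k) (hN k) => // u _; exists u.
    apply: (@limit_clique_free (v \o g)) => x /hE[[x' e Mx]|[_ [k]]]; last first.
      by rewrite /= gP.
    suff -> : (v \o g) \o x = v \o x' by [].
    apply: funext => k; have := congr1 (@^~ k) e; by rewrite /= gP => -[->].
  (* There are [r < s] colours, so two vertices of the clique share one; neither is [None], and an
     edge through both and [None] would not be rainbow. *)
  have [k1 [k2 [k12 ck]]] : exists k1 k2, k1 != k2 /\ omap c (h k1) = omap c (h k2).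
    apply: contrapT => H; have : injective (omap c \o h).
      move=> k1 k2 e; apply/eqP/negPn/negP => ne; by apply: H; exists k1, k2.
    move=> /(@leq_card 'I_s (option 'I_r.-1)); rewrite card_option.
    rewrite (card_ord s) (card_ord r.-1) (@prednK r) ?(ltn_trans _ r3)//.
    by rewrite leqNgt rs.
  have hk1 : k1 != k0.
    apply: contraNneq k12 => k10; move: ck; rewrite k10 hk0 -hk0 => e; apply/eqP/hinj.
    by move: e; rewrite hk0; case: (h k2).
  have hk2 : k2 != k0.
    apply: contraNneq k12 => k20; move: ck; rewrite k20 hk0 -hk0 => e; apply/eqP/hinj.
    by move: e; rewrite hk0; case: (h k1).
  have [|||x xinj xP] := @injection_through r s [:: k0; k1; k2] => //.
    by rewrite /= !inE negb_or eq_sym hk1 eq_sym hk2 k12.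
    exact: ltnW.
  have [a xa] := xP k0 (mem_head _ _).
  have [a1 xa1] : exists i, x i = k1 by apply: xP; rewrite !inE eqxx orbT.
  have [a2 xa2] : exists i, x i = k2 by apply: xP; rewrite !inE eqxx !orbT.
  have [[x' /(congr1 (@^~ a)) /=]|[cinj _]] := hE x xinj; first by rewrite xa hk0.
  have a12 : a1 = a2 by apply: cinj; rewrite /= xa1 xa2.
  by move: k12; rewrite -xa1 -xa2 a12 eqxx.
have [_ _ homog] := ML.
pose A := range (f \o Some).
have Afin : finite_set A by exact: finite_image.
have /choice[w wP] : forall x : substructure A, exists u, f (Some u) = set_val x.
  by move=> x; have [u _ ux] := set_valP x; exists u.
(* [g] extends the partial isomorphism taking [f (Some u)] to [v u]; the required vertex is
   [g (f None)]. *)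
have [|g [[ginj gE] _] gP] := homog A (v \o w) Afin.
  split=> [x y /= /vinj e|x]; first by apply: val_inj; rewrite -[LHS]wP e wP.
  have -> : interp (substructure A) x = interp M (f \o (Some \o (w \o x))).
    by rewrite /=; congr interp; apply: funext => k /=; rewrite wP.
  rewrite -fE; split=> [[[x' e]|[_ []]] //|?]; last by left; exists (w \o x).
  suff -> : v \o w \o x = v \o x' by [].
  by apply: funext => k /=; have [->] := congr1 (@^~ k) e.
exists (g (f None)) => i ci.
have gv u : g (f (Some u)) = v u.
  have Au : A (f (Some u)) by exists u.
  pose u' : substructure A := SigSub (mem_set Au).
  rewrite -[f (Some u)]/(set_val u') gP /=; congr v.
  have /finj[//] := wP u'.
have -> : snoc (v \o i) (g (f None)) = g \o (f \o snoc (Some \o i) None).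
  by apply: funext => k; rewrite /snoc /=; case: insub => [k'|] //=; rewrite gv.
apply: (gE (f \o snoc (Some \o i) None)).1; apply: (fE (snoc (Some \o i) None)).1; right; split.
  move=> k l; rewrite /snoc /=.
  case: insubP => [k' _ k'k|nk]; case: insubP => [l' _ l'l|nl] //=.
    by move=> [/eqP]; rewrite !ci => /eqP e; apply: val_inj; rewrite /= -[LHS]k'k e.
  have last_ord (q : 'I_r) : ~~ (q < r.-1) -> val q = r.-1.
    move=> nq; apply/eqP; rewrite eqn_leq [r.-1 <= _]leqNgt nq andbT.
    by rewrite -ltnS prednK; [exact: ltn_ord | exact: ltn_trans r3].
  by move=> _; apply: val_inj; rewrite (last_ord k nk) (last_ord l nl).
have rr : r.-1 < r by rewrite ltn_predL; apply: ltn_trans r3.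
by exists (Ordinal rr); rewrite /snoc insubF //= ltnn.
Qed.

End FraisseLimit.

(** * Colourings and elementary extensions *)

(** Overwriting a colouring on the tuple [i] by the prescribed colours, while remembering the old
    ones, is injective. *)
Lemma colouring_count m d (i : 'I_d -> 'I_m) : injective i ->
  #|{ffun 'I_m -> 'I_d}| <=
  #|[set c : {ffun 'I_m -> 'I_d} | [forall k, c (i k) == k]]%SET| * d ^ d.
Proof.
move=> iinj; set R := [set c | _]%SET.
pose F (c : {ffun 'I_m -> 'I_d}) :=
  ([ffun x => if [pick k | i k == x] is Some k then k else c x], [ffun k => c (i k)]).
have Finj : injective F.
  move=> c c' [/ffunP e1 /ffunP e2]; apply/ffunP => x.
  move: (e1 x); rewrite !ffunE; case: pickP => [k /eqP <- _|//].
  by move: (e2 k); rewrite !ffunE.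
rewrite -cardsT -(card_imset _ Finj).
apply: (@leq_trans #|finset.setX R [set: {ffun 'I_d -> 'I_d}]%SET|); last first.
  by rewrite cardsX cardsT card_ffun card_ord.
apply/subset_leq_card/fintype.subsetP => _ /imsetP[c _ ->]; rewrite !inE andbT.
apply/forallP => k; rewrite ffunE; case: pickP => [l /eqP/iinj -> //|/(_ k)].
by rewrite eqxx.
Qed.

(** Double counting of pairs of a colouring and a tuple: some colouring does at least as well as the
    average. *)
Lemma rainbow_colouring q m d (i : 'I_q -> 'I_d -> 'I_m) : 0 < d ->
  exists c : 'I_m -> 'I_d, #|[set t | injectiveb (i t)]%SET| <=
    d ^ d * #|[set t | [forall k, c (i t k) == k]]%SET|.
Proof.
move=> d0; set I := #|_|; apply: contrapT => /forallNP H.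
pose C : finType := {ffun 'I_m -> 'I_d}.
pose rb (c : C) := #|[set t | [forall k, c (i t k) == k]]%SET|.
have C0 : 0 < #|C| by apply/card_gt0P; exists [ffun=> Ordinal d0].
(* If all colourings fell short, each would lose at least 1, and there is at least one colouring. *)
have lt : \sum_(c : C) (d ^ d * rb c).+1 <= #|C| * I.
  by rewrite -sum_nat_const; apply: leq_sum => c _; rewrite ltnNge; apply/negP/H.
have le : #|C| * I <= \sum_(c : C) d ^ d * rb c.
  rewrite -big_distrr /=.
  have -> : \sum_c rb c = \sum_t #|[set c : C | [forall k, c (i t k) == k]]%SET|.
    under eq_bigr do rewrite /rb -sum1_card big_mkcond.
    under [RHS]eq_bigr do rewrite -sum1_card big_mkcond.
    rewrite exchange_big /=; apply: eq_bigr => t _; apply: eq_bigr => c _.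
    by rewrite !inE.
  rewrite mulnC /I -sum_nat_const big_distrr /= [leqRHS](bigID (fun t => injectiveb (i t))) /=.
  apply: (leq_trans _ (leq_addr _ _)).
  rewrite (eq_bigl (fun t => injectiveb (i t))); last by move=> t; rewrite inE.
  by apply: leq_sum => t /injectiveP /colouring_count; rewrite mulnC.
have := leq_trans lt le; under eq_bigr do rewrite -addn1.
by rewrite big_split /= sum1_card -[leqRHS]addn0 leq_add2l leqNgt C0.
Qed.

Section ElementaryExtension.
Variables (r : nat) (M U : structure r) (j : M -> U).
Hypothesis jE : elementary j.

Lemma elementary_rgraph : is_rgraph M -> is_rgraph U.
Proof.
move=> [Minj Mperm]; split=> [x Ux k l xkl|p x Ux].
  apply/eqP/negPn/negP => kl.
  have := elementary_forall jE (a := fImp (fRel id) (fNot (fEq k l))).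
  move=> /(_ _ x Ux xkl); apply => e /= /Minj einj /einj/eqP.
  by rewrite (negbTE kl).
have := elementary_forall jE (a := fImp (fRel id) (fRel p)).
by move=> /(_ _ x Ux); apply=> e /=; apply: Mperm.
Qed.

Lemma elementary_clique_free s : (forall h : 'I_s -> M, ~ clique_map (interp M) h) ->
  forall h : 'I_s -> U, ~ clique_map (interp U) h.
Proof.
move=> Mfree h hE.
pose a : formula r 'I_s :=
  fNot (\big[fAnd/fTop]_(x : {ffun 'I_r -> 'I_s} | injectiveb x) fRel x).
have := elementary_forall jE (a := a).
move=> /(_ _ h); apply; last by apply/sat_bigAnd => x /injectiveP; apply: hE.
move=> e /sat_bigAnd ea; apply: (Mfree e) => x xinj.
have -> : x = finfun x by apply: funext => k; rewrite ffunE.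
by apply: ea; apply/injectiveP => k l; rewrite !ffunE; apply: xinj.
Qed.

(** For fixed [m] and [c] the extension property is a first-order formula in [v]: the condition on
    [i] is a finite conjunction. *)
Lemma elementary_extension m (c : 'I_m -> 'I_r.-1) :
  (forall v : 'I_m -> M, injective v -> exists y, forall i : 'I_r.-1 -> 'I_m,
     (forall k, c (i k) = k) -> interp M (snoc (v \o i) y)) ->
  forall v : 'I_m -> U, injective v -> exists y, forall i : 'I_r.-1 -> 'I_m,
     (forall k, c (i k) = k) -> interp U (snoc (v \o i) y).
Proof.
move=> Mext v vinj.
pose inj_form : formula r 'I_m :=
  \big[fAnd/fTop]_(kl : 'I_m * 'I_m | kl.1 != kl.2) fNot (fEq kl.1 kl.2).
pose ext_form : formula r (option 'I_m) :=
  \big[fAnd/fTop]_(i : {ffun 'I_r.-1 -> 'I_m} | [forall k, c (i k) == k])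
    fRel (snoc (Some \o i) None).
have inj_formP (A : structure r) (e : 'I_m -> A) : sat e inj_form <-> injective e.
  split=> [/sat_bigAnd H k l ekl|einj].
    by apply/eqP/negPn/negP => kl; apply: (H (k, l) kl).
  by apply/sat_bigAnd => -[k l] /= kl /einj/eqP; rewrite (negbTE kl).
have ext_formP (A : structure r) (e : 'I_m -> A) (y : A) :
    sat (oapp e y) ext_form <-> forall i : 'I_r.-1 -> 'I_m,
      (forall k, c (i k) = k) -> interp A (snoc (e \o i) y).
  have snocE (i : 'I_r.-1 -> 'I_m) : oapp e y \o snoc (Some \o i) None = snoc (e \o i) y.
    by apply: funext => k; rewrite /snoc /=; case: insub.
  split=> [/sat_bigAnd H i ci|H].
    rewrite -snocE; have -> : i = finfun i by apply: funext => k; rewrite ffunE.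
    by apply: H; apply/forallP => k; rewrite ffunE ci.
  apply/sat_bigAnd => i /forallP ci /=; rewrite snocE; apply: H => k; exact/eqP.
have := elementary_forall jE (a := fImp inj_form (fNot (fAll (fNot ext_form)))).
move=> /(_ _ v (proj2 (inj_formP _ _) vinj)) H.
apply: contrapT => /forallNP N; apply: H => [e /inj_formP/Mext[y yP] /= /(_ y)|u].
  by apply; apply/ext_formP.
by move=> /ext_formP; apply: N.
Qed.

End ElementaryExtension.

Lemma psat_phi_nonedge r (U : structure r) (a : 'I_r.-1 -> U) (b : 'I_1 -> U) :
  psat a (instance (phi_nonedge r) b) <->
  ~ interp U (snoc a (b ord0)) /\ injective a.
Proof.
rewrite /psat sat_form_map sat_fAnd.
have -> : (sum_case a id \o sum_case inl (inr \o b)) = sum_case a b.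
  by apply: funext => -[].
rewrite sat_bigAnd.
have -> : sat (sum_case a b) (fNot (fRel (snoc inl (inr ord0)))) <->
    ~ interp U (snoc a (b ord0)).
  rewrite /=; have -> // : sum_case a b \o snoc inl (inr ord0) = snoc a (b ord0).
  by apply: funext => k; rewrite /snoc /=; case: insub.
split=> -[nR H]; split=> //.
  by move=> k l akl; apply/eqP/negPn/negP => kl; apply: (H (k, l) kl).
by move=> [k l] /= kl /H/eqP; rewrite (negbTE kl).
Qed.

Lemma finite_indexing (P : finType) (T : Type) (f : P -> T) :
  exists m (v : 'I_m -> T) (i : P -> 'I_m), injective v /\ forall p, f p = v (i p).
Proof.
pose V : seq {classic T} := undup [seq (f p : {classic T}) | p <- enum P].
have fV p : (f p : {classic T}) \in V by rewrite mem_undup map_f ?mem_enum.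
exists (size V), (tnth (in_tuple V)).
have /choice[i iP] : forall p, exists k, tnth (in_tuple V) k = f p.
  by move=> p; have /tnthP[k ->] : (f p : {classic T}) \in in_tuple V by []; exists k.
have vinj : injective (tnth (in_tuple V)) by apply/tuple_uniqP; exact: undup_uniq.
by exists i; split.
Qed.

(** * The nonedge type *)

Section NonedgeType.
Variables (r s : nat) (M U : structure r) (j : M -> U).
Hypotheses (r3 : 3 <= r) (rs : r < s).
Hypotheses (ML : fraisse_limit (clique_free_rgraph s) M) (jE : elementary j).

Lemma links_do_not_cover n (b : 'I_n -> U) : exists a : 'I_r.-1 -> M,
  injective a /\ forall i, ~ interp U (snoc (j \o a) (b i)).
Proof.
apply: contrapT => /forallNP H.
have Mrg := limit_rgraph ML; have Urg := elementary_rgraph jE Mrg.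
have [jinj jR] := elementary_embedding jE.
have [X [E [Einj Eperm Efree Eramsey]]] := clique_ramsey (option 'I_n) r3 rs.
have [f [finj fE]] := limit_embeds ML Einj Eperm Efree.
(* [chi u] is some [i] with [b i] joined to the tuple listed by [u], and [None] if there is no such
   [i]. *)
pose chi (u : seq X) := [pick i | `[< exists2 a : 'I_r.-1 -> X,
  u = map a (enum 'I_r.-1) & interp U (snoc (j \o f \o a) (b i)) >]].
have [K [c [uK KE chiK]]] := Eramsey chi.
have sK : r.-1 <= size K by rewrite size_tuple -!subn1 leq_sub2r// ltnW.
(* By assumption the first [r - 1] vertices of [K] are joined to some [b i], so the common colour is
   not [None]. *)
have [i0 ci0] : exists i0, c = Some i0.
  have su : size (take r.-1 K) == r.-1 by rewrite size_takel.
  rewrite -(chiK (take r.-1 K)) ?take_subseq//; last exact/eqP.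
  rewrite /chi; case: pickP => [i _|N]; first by exists i.
  pose a := tnth (Tuple su).
  have ainj : injective a by apply/tuple_uniqP; exact: take_uniq.
  have [] := H (f \o a); split; first by move=> k l /finj/ainj.
  move=> i Ri; have /asboolP[] := N i; exists a => //.
  by rewrite map_tnth_enum.
(* Appending [b i0] to [K] gives an [s]-clique in [U]: a tuple either stays in [K] or uses the last
   index at one place [k0]. *)
apply: (elementary_clique_free jE (limit_clique_free r3 rs ML)
  (h := snoc (j \o f \o tnth K) (b i0))) => x xinj.
have Kinj : injective (tnth K) by apply/tuple_uniqP.
have [[k0 xk0]|/forallNP xlt] := pselect (exists k0, s.-1 <= x k0); last first.
  have {}xlt k : x k < s.-1 by rewrite ltnNge; apply/negP/xlt.
  have -> : snoc (j \o f \o tnth K) (b i0) \o x =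
      j \o (f \o (fun k => tnth K (Ordinal (xlt k)))).
    by apply: funext => k; rewrite /= snoc_lt.
  apply/jR/fE/KE => [k l /Kinj [] /val_inj/xinj//|k]; exact: mem_tnth.
have /choice[y yP] : forall q, exists l : 'I_s.-1, val l = x (lift k0 q).
  move=> q; suff lt : x (lift k0 q) < s.-1 by exists (Ordinal lt).
  rewrite ltnNge; apply/negP => le; have := neq_lift k0 q.
  suff /xinj <- : x k0 = x (lift k0 q) by rewrite eqxx.
  have s1 : s.-1.+1 = s by rewrite prednK// (leq_ltn_trans _ rs).
  have last_eq (i : 'I_s) : s.-1 <= i -> val i = s.-1.
    by move=> si; apply/eqP; rewrite eqn_leq si andbT -ltnS s1 ltn_ord.
  by apply: val_inj; rewrite (last_eq _ xk0) (last_eq _ le).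
have yinj : injective y.
  move=> q q' /(congr1 val); rewrite !yP => /val_inj/xinj; exact: lift_inj.
(* The colour is known for subsequences of [K] only, so the other [r - 1] indices are listed in
   increasing order; [rgraph_range] reorders the edge. *)
pose u := map (tnth K) (enum (codom y)).
have uK' : subseq u K.
  rewrite -[tval K]map_tnth_enum; apply: map_subseq.
  rewrite [X in subseq X _]/enum_mem enumT; exact: filter_subseq.
have su : size u = r.-1 by rewrite size_map -cardE card_codom// card_ord.
have := chiK u uK' su; rewrite ci0 /chi; case: pickP => // i /asboolP[a ua Ra] [ii].
rewrite {}ii in Ra; apply: (rgraph_range Urg _ Ra) => l.
case: (ltnP l r.-1) => [lr|rl]; last first.
  by exists k0; rewrite /= !snoc_last.
have : a (Ordinal lr) \in u by rewrite ua map_f// mem_enum.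
move=> /mapP[l']; rewrite mem_enum => /codomP[q ->] aq.
have lt : x (lift k0 q) < s.-1 by rewrite -yP ltn_ord.
exists (lift k0 q); rewrite /= (snoc_lt _ _ lt) (snoc_lt _ _ lr) /= aq.
by congr (j (f (tnth K _))); apply: val_inj; rewrite /= yP.
Qed.


(** Take [y] joined to the tuples that a good colouring makes rainbow. The formula fails at these
    and at all tuples with repetitions. *)
Lemma nonedge_missed q (a : 'I_q -> 'I_r.-1 -> U) : exists b : 'I_1 -> U,
  q <= r.-1 ^ r.-1 * #|[set t | ~~ `[< psat (a t) (instance (phi_nonedge r) b) >]]%SET|.
Proof.
have [m [v [i [vinj aE]]]] := finite_indexing (fun p : 'I_q * 'I_r.-1 => a p.1 p.2).
have r0 : 0 < r.-1 by rewrite -ltnS prednK//; apply: leq_ltn_trans r3.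
pose it t k := i (t, k).
have itP t : a t = v \o it t by apply: funext => k; rewrite /= -aE.
have [c cP] := rainbow_colouring it r0.
have [y yP] := elementary_extension jE (fun w => limit_extension r3 rs ML c (v := w)) vinj.
exists (fun=> y); set F := [set t | _]%SET.
set I := [set t | injectiveb (it t)]%SET in cP.
set B := [set t | [forall k, c (it t k) == k]]%SET in cP.
have BI : B \subset I.
  apply/fintype.subsetP => t; rewrite !inE => /forallP ct; apply/injectiveP => k l kl.
  by rewrite -(eqP (ct k)) kl (eqP (ct l)).
have BF : B :|: ~: I \subset F.
  apply/fintype.subsetP => t; rewrite !inE => /orP[/forallP ct|/injectiveP nI].
    apply/asboolP => /psat_phi_nonedge[+ _]; rewrite itP; apply; apply: yP => k.
    exact/eqP/ct.
  apply/asboolP => /psat_phi_nonedge[_]; rewrite itP => H; apply: nI => k l kl.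
  by apply: H; rewrite /= kl.
have card_BI : #|B :|: ~: I| = #|B| + #|~: I|.
  by apply/eqP; rewrite (leq_card_setU _ _).2 finset.disjoints_subset finset.setCK.
apply: (@leq_trans (r.-1 ^ r.-1 * (#|B| + #|~: I|))); last first.
  by rewrite -card_BI leq_mul2l subset_leq_card ?orbT.
rewrite -{1}(card_ord q) -(cardsC I) mulnDr leq_add// leq_pmull//.
by rewrite expn_gt0 r0.
Qed.

End NonedgeType.

(** * Complete types made of positive instances, and the properties of the nonedge type *)

Lemma phi_type_eq r n m (U : structure r) (phi : formula r ('I_n + 'I_m))
    (p : set (formula r ('I_n + U))) :
  complete_type phi p -> (forall b, p (instance phi b)) -> p = range (instance phi).
Proof.
move=> [psub pcons _] pP; apply/seteqP; split=> [psi ppsi|_ [b _ <-]//].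
have [b [->|E]] := psub _ ppsi; first by exists b.
have [|psi'|a [_ aP]] := pcons [set instance phi b; fNot (instance phi b)].
- exact: finite_set2.
- by case=> ->; [exact: pP|rewrite -E].
- by have := aP _ (or_intror erefl); case; apply: aP; left.
Qed.

(** Maximality holds because a consistent extension cannot contain the negation of an instance. *)
Lemma complete_type_range r n m (U : structure r) (phi : formula r ('I_n + 'I_m)) :
  consistent (range (instance phi) : set (formula r ('I_n + U))) ->
  complete_type phi (range (instance phi) : set (formula r ('I_n + U))).
Proof.
move=> cons; split=> //; first by move=> _ [b _ <-]; exists b; left.
move=> q qsub qcons pq psi qpsi; have [b [->|E]] := qsub _ qpsi; first by exists b.
have [|psi'|a [_ aP]] := qcons [set instance phi b; fNot (instance phi b)].
- exact: finite_set2.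
- by case=> ->; [apply: pq; exists b|rewrite -E].
- by have := aP _ (or_intror erefl); case; apply: aP; left.
Qed.

Lemma small_countable (K T : Type) (A : set T) :
  ~ countable [set: K] -> countable A -> small K A.
Proof.
move=> Kunc Actbl; split; last by move=> /sub_countable/(_ Actbl).
apply: card_le_trans Actbl _; apply/infiniteP => /finite_set_countable; exact: Kunc.
Qed.

Theorem theorem5p13 (R : realType) (r s : nat) (M U : structure r) (K : Type)
    (j : M -> U) :
  (3 <= r)%N -> (r < s)%N ->
  fraisse_limit (clique_free_rgraph s) M ->
  elementary j ->
  ~ countable [set: K] -> saturated K U ->
  (exists! p : set (formula r ('I_r.-1 + U)),
     complete_type (phi_nonedge r) p /\ forall b, p (instance (phi_nonedge r) b)) /\
  (forall p : set (formula r ('I_r.-1 + U)),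
     complete_type (phi_nonedge r) p -> (forall b, p (instance (phi_nonedge r) b)) ->
     [/\ dfs_type K (phi_nonedge r) p,
         finitely_satisfiable (range j) p &
         ~ finitely_approximated R K (phi_nonedge r) p]).
Proof.
move=> r3 rs ML jE Kunc _; set phi := phi_nonedge r.
pose p0 : set (formula r ('I_r.-1 + U)) := range (instance phi).
have r0 : (0 < r.-1)%N by rewrite -ltnS prednK//; apply: leq_ltn_trans r3.
(* The case of no parameters yields a tuple of [M], so [U] is inhabited; [u0] serves as a default
   parameter. *)
have [u0 _] : exists u0 : U, True.
  have [a _] := links_do_not_cover r3 rs ML jE
    (fun i : 'I_0 => False_rect U (notF (ltn_ord i))).
  by exists (j (a (Ordinal r0))).
have p0fs : finitely_satisfiable (range j) p0.
  move=> F /finite_enum[n [psi psiP]] Fp.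
  have /choice[b bP] : forall i, exists b : 'I_1 -> U, F (psi i) -> psi i = instance phi b.
    move=> i; case: (pselect (F (psi i))) => [/Fp[b _ <-]|nF]; first by exists b.
    by exists (fun=> u0) => /nF.
  have [a [ainj aP]] := links_do_not_cover r3 rs ML jE (fun i => b i ord0).
  exists (j \o a); split=> [i|chi Fchi]; first by exists (a i).
  have [i ichi] := psiP _ Fchi; rewrite -ichi in Fchi *.
  rewrite (bP i Fchi); apply/psat_phi_nonedge; split; first exact: aP.
  exact: inj_comp (elementary_embedding jE).1 ainj.
have p0c : complete_type phi p0.
  apply: complete_type_range => F finF Fp0; have [a [_ aP]] := p0fs F finF Fp0.
  by exists a.
split.
  by exists p0; split=> [|p [pc pP]]; [split=> // b; exists b | rewrite (phi_type_eq pc pP)].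
move=> p pc pP; rewrite {pc pP}(phi_type_eq pc pP) -/p0; split=> //.
  (* All instances lie in [p0], so [fTop] is a defining formula. *)
  split; first by exists fTop => b; split=> [_ []//|_]; exists b.
  exists (range j); split=> //; last exact: elementary_sub_range.
  apply: small_countable => //; have [Mctbl _ _] := ML.
  apply: card_le_trans Mctbl; exact: card_image_le.
move=> [N [_ _ approx]].
have psatE (a : 'I_r.-1 -> U) c :
    psat a (instance (instance phi id) c) <-> psat a (instance phi c).
  rewrite /psat !sat_form_map.
  suff -> : ((sum_case a id \o sum_case inl (inr \o c)) \o sum_case inl (inr \o id)) =
    sum_case a id \o sum_case inl (inr \o c) by [].
  by apply: funext => -[].
(* [D^-1] is the share of tuples missed in [nonedge_missed]; it is the tolerance, tested on [phi]
   itself. *)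
pose D : R := ((r.-1 ^ r.-1)%N%:R)%R.
have D0 : (0 < D)%R.
  by rewrite ltr0n expn_gt0 r0.
have D1 : (0 < D^-1)%R by rewrite invr_gt0.
have [q [a [q0 _ aP]]] := approx 1 (instance phi id) (D^-1)%R (bc_atom phi id) D1.
have [b bP] := nonedge_missed r3 rs ML jE a.
(* The instance at [b] has measure 1, yet at least [q / D] of the [q] sample tuples fail it, so the
   error is at least [D^-1]. *)
have := aP b; rewrite /type_measure asboolT; last first.
  exists [set instance phi b]; split; first exact: finite_set1.
    by move=> _ ->; exists b.
  by move=> a' Ha; apply/psatE/Ha.
set S := [set t | _]%SET => lt.
have qE : q = (#|S| + #|~: S|)%N by rewrite cardsC card_ord.
have SE : #|~: S| = #|[set t | ~~ `[< psat (a t) (instance phi b) >]]%SET|.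
  apply: eq_card => t; rewrite !inE; congr (~~ _); exact/asbool_equiv_eq/psatE.
move: lt; rewrite ltNge => /negP; apply; rewrite ler_normr; apply/orP; left.
have q0R : (0 < q%:R :> R)%R by rewrite ltr0n.
rewrite -[X in (X - _)%R](divff (lt0r_neq0 q0R)) -mulrBl ler_pdivlMr// mulrC ler_pdivrMr//.
rewrite -natrB; last by rewrite [leqRHS]qE leq_addr.
rewrite -natrM ler_nat {2}qE addKn SE mulnC; exact: bP.
Qed.
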